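(* Let $k\in\mathbb{N}$, $h_1,h_2\in\mathbb{Z}$ with $\gcd(h_1,k)=\gcd(h_2,k)=1$, and let $s_1,s_2\in\mathbb{C}$ with $\Re s_1>1$ and $\Re s_2>1$. Define $$D:=\sum_{a=1}^{k-1}\zeta\left(s_1,\left\{\frac{ah_1}{k}\right\}\right)\zeta\left(s_2,\left\{\frac{ah_2}{k}\right\}\right).$$ Then $$D=(k^{s_1+s_2-1}-1)\zeta(s_1)\zeta(s_2)+k^{s_1+s_2-1}\sum_{a=1}^{k-1}F\left(s_1,\frac{ah_2}{k}\right)F\left(s_2,-\frac{ah_1}{k}\right).$$
   Context: $\{x\}=x-\lfloor x\rfloor$ is the fractional part. For $0<x\le 1$, $\zeta(s,x):=\sum_{n=0}^\infty (n+x)^{-s}$ is the Hurwitz zeta function, and $\zeta(s)=\zeta(s,1)$ is the Riemann zeta function. For real $x$, $F(s,x):=\sum_{n=1}^\infty e^{2\pi i n x}n^{-s}$ is the periodic zeta function (convergent for $\Re s>1$). *)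

(* Defs.v *)
From HB Require Import structures.
From mathcomp Require Import all_boot all_order all_algebra.
From mathcomp Require Import all_classical all_reals all_analysis.
From mathcomp Require Export complex.

Set Implicit Arguments.
Unset Strict Implicit.
Unset Printing Implicit Defensive.

Import Order.TTheory GRing.Theory Num.Theory.
Import numFieldNormedType.Exports.

Local Open Scope ring_scope.
Local Open Scope complex_scope.

Definition fracpart (R : realType) (x : R) : R := x - (Num.floor x)%:~R.

Definition cexp (R : realType) (z : R[i]) : R[i] :=
  (expR (complex.Re z))%:C * (cos (complex.Im z) +i* sin (complex.Im z)).

(* Meaningful for 0 < x only, since [ln] is 0 on nonpositive reals. *)
Definition cpow (R : realType) (x : R) (s : R[i]) : R[i] :=
  cexp (s * (ln x)%:C).

(* The topology of C is the one induced by the modulus; the library attaches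
   it to the alias [R[i]^o].  [limn] has an unspecified value when the series
   diverges, so the next two definitions are meaningful for 1 < Re s (and
   0 < x <= 1 in the first). *)
Definition hurwitz_zeta (R : realType) (s : R[i]) (x : R) : R[i] :=
  limn (series (fun n : nat => cpow (n%:R + x) (- s)) : nat -> R[i]^o).

Definition riemann_zeta (R : realType) (s : R[i]) : R[i] := hurwitz_zeta s 1.

(* The summation index is shifted so that the series starts at n = 1. *)
Definition periodic_zeta (R : realType) (s : R[i]) (x : R) : R[i] :=
  limn (series (fun n : nat =>
    cexp (2 * pi%:C * 'i%C * n.+1%:R * x%:C) * cpow n.+1%:R (- s))
    : nat -> R[i]^o).

(* Main.v *)
(* Splitting the series of F(s, b/k) according to the residue of the index
   modulo k gives F(s, b/k) = k^(-s) sum_(1 <= r <= k) e(rb/k) zeta(s, r/k),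
   with e(x) = exp(2 pi i x).  Hence the sum of F(s1, a h2/k) F(s2, -a h1/k)
   over all a mod k is k^(-s1-s2) times the sum over r, t of
   zeta(s1, r/k) zeta(s2, t/k) sum_a e(a (r h2 - t h1)/k).  By orthogonality
   only the pairs with r h2 = t h1 (mod k) survive; since h1 and h2 are units
   these are r = a h1, t = a h2 for a mod k.  The terms a = 0 on both sides are
   zeta(s1) zeta(s2). *)
Require Import Defs.
From HB Require Import structures.
From mathcomp Require Import all_boot all_order all_algebra.
From mathcomp Require Import all_classical all_reals all_analysis.
From mathcomp Require Import ring lra zify.

Import Order.TTheory GRing.Theory Num.Theory.
Import numFieldNormedType.Exports.

Local Open Scope ring_scope.
Local Open Scope complex_scope.

(** * Complex exponential and powers *)

Lemma norm_i {R : realType} : `|'i%C : R[i]| = 1.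
Proof. by rewrite normc_def /= expr0n expr1n add0r sqrtr1. Qed.

Lemma cexp0 {R : realType} : cexp (0 : R[i]) = 1.
Proof. by rewrite /cexp /= expR0 cos0 sin0 mul1r. Qed.

Lemma cexpD {R : realType} (z w : R[i]) : cexp (z + w) = cexp z * cexp w.
Proof.
case: z w => [a b] [c d]; rewrite /cexp /= expRD cosD sinD.
by apply/eqP; rewrite eq_complex /=; apply/andP; split; apply/eqP; ring.
Qed.

Lemma norm_cexp {R : realType} (z : R[i]) :
  `|cexp z| = (expR (complex.Re z))%:C.
Proof.
rewrite normc_def /cexp /= !mul0r subr0 addr0 !exprMn -mulrDr cos2Dsin2 mulr1.
by rewrite sqrtr_sqr ger0_norm// expR_ge0.
Qed.

Lemma cpowM {R : realType} (x y : R) (s : R[i]) :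
  0 < x -> 0 < y -> cpow (x * y) s = cpow x s * cpow y s.
Proof.
by move=> x0 y0; rewrite /cpow lnM ?posrE// rmorphD mulrDr cexpD.
Qed.

Lemma cpowD {R : realType} (x : R) (s t : R[i]) :
  cpow x (s + t) = cpow x s * cpow x t.
Proof. by rewrite /cpow mulrDl cexpD. Qed.

Lemma cpow_r1 {R : realType} (x : R) : 0 < x -> cpow x 1 = x%:C.
Proof.
by move=> x0; rewrite /cpow mul1r /cexp /= cos0 sin0 lnK ?posrE// mulr1.
Qed.

Lemma norm_cpow {R : realType} (x : R) (s : R[i]) :
  `|cpow x s| = (expR (complex.Re s * ln x))%:C.
Proof. by rewrite norm_cexp; case: s => a b /=; rewrite mulr0 subr0. Qed.

(** * The character e(x) = exp(2 pi i x) *)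

Definition unit_char {R : realType} (x : R) : R[i] :=
  cexp (2 * pi%:C * 'i%C * x%:C).

Lemma unit_charE {R : realType} (x : R) :
  unit_char x = cos (pi * x *+ 2) +i* sin (pi * x *+ 2).
Proof.
rewrite /unit_char /cexp.
have -> : 2 * pi%:C * 'i%C * x%:C = 0 +i* (pi * x *+ 2) :> R[i].
  by apply/eqP; rewrite eq_complex /=; apply/andP; split; apply/eqP; ring.
by rewrite /= expR0 mul1r.
Qed.

Lemma unit_char0 {R : realType} : unit_char (0 : R) = 1.
Proof. by rewrite /unit_char mulr0 cexp0. Qed.

Lemma unit_charD {R : realType} (x y : R) :
  unit_char (x + y) = unit_char x * unit_char y.
Proof. by rewrite /unit_char -cexpD -mulrDr -rmorphD. Qed.

Lemma unit_charMn {R : realType} (x : R) (n : nat) :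
  unit_char (n%:R * x) = unit_char x ^+ n.
Proof.
elim: n => [|n IHn]; first by rewrite mul0r unit_char0.
by rewrite -natr1 mulrDl mul1r unit_charD IHn exprSr.
Qed.

Lemma unit_char1 {R : realType} : unit_char (1 : R) = 1.
Proof. by rewrite unit_charE mulr1 cos2pi sin2pi. Qed.

Lemma unit_char_int {R : realType} (m : int) : unit_char (m%:~R : R) = 1.
Proof.
have nat1 n : unit_char (n%:R : R) = 1.
  by rewrite -[n%:R]mulr1 unit_charMn unit_char1 expr1n.
case: m => n; first exact: nat1.
apply: (mulIr (x := unit_char (n.+1%:R : R))).
  by rewrite nat1 unitr1.
by rewrite -unit_charD NegzE rmorphN /= addNr unit_char0 nat1 mul1r.
Qed.

(** Comparing real parts leaves sin(pi x) = 0, while the sine is positive strictly between 0 and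
    pi. *)
Lemma unit_char_eq1 {R : realType} (x : R) :
  0 <= x < 1 -> unit_char x = 1 -> x = 0.
Proof.
move=> /andP[x0 x1]; rewrite unit_charE => -[+ _].
rewrite cos_mulr2n cos2sin2 => c1.
have /eqP : sin (pi * x) ^+ 2 = 0 by move: c1; rewrite !mulr2n; lra.
rewrite expf_eq0 /= => /eqP s0.
case: (ltgtP 0 x) x0 => // {}x0 _.
have := @sin_gt0_pi R (pi * x); rewrite s0 ltxx mulr_gt0 ?pi_gt0//=.
by rewrite gtr_pMr ?pi_gt0// x1 => /(_ isT).
Qed.

(** * Convergence of the series *)

(* This is e^u >= 1 + u for u = p ln((x + 1) / x). *)
Lemma telescope_power_bound {R : realType} (p x : R) : 0 < p -> 0 < x ->
  p * expR (- (p + 1) * ln (x + 1)) <=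
    expR (- p * ln x) - expR (- p * ln (x + 1)).
Proof.
move=> p0 x0; have x10 : 0 < x + 1 by lra.
have -> : expR (- (p + 1) * ln (x + 1)) = expR (- p * ln (x + 1)) / (x + 1).
  by rewrite opprD mulrDl mulN1r expRD expRN lnK.
have -> : - p * ln x = - p * ln (x + 1) + p * (ln (x + 1) - ln x) by ring.
rewrite expRD.
(* Taking y = -1/(x + 1) in ln(1 + y) <= y gives ln(x/(x + 1)) <= -1/(x + 1). *)
have h : (x + 1)^-1 <= ln (x + 1) - ln x.
  have := @le_ln1Dx R (- (x + 1)^-1).
  have -> : 1 - (x + 1)^-1 = x / (x + 1) by field; lra.
  rewrite ltrN2 invf_lt1// ltrDr x0 ln_div// => /(_ isT); lra.
have h2 := expR_ge1Dx (p * (ln (x + 1) - ln x)).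
have h3 : p * (x + 1)^-1 <= p * (ln (x + 1) - ln x) by rewrite ler_pM2l.
have e0 := expR_gt0 (- p * ln (x + 1)).
rewrite mulrCA -[X in _ <= _ - X]mulr1 -mulrBr ler_pM2l//; lra.
Qed.

Lemma cvg_pseries {R : realType} (q x : R) : 1 < q -> 0 < x ->
  cvgn (series (fun n => expR (- q * ln (n%:R + x)))).
Proof.
move=> q1 x0; set t := fun n => _.
(* The telescoping bound is summed with p = q - 1. It controls the term n + 1 from the point n + x,
   so the term 0 is set apart. *)
have bnd n : (q - 1) * (series t n.+1 - t 0%N) <=
    expR (- (q - 1) * ln x) - expR (- (q - 1) * ln (n%:R + x)).
  elim: n => [|n IHn].
    by rewrite seriesEnat /= big_nat1 subrr mulr0 add0r subrr.
  have nx0 : 0 < n%:R + x by rewrite ltr_wpDl.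
  have q0 : 0 < q - 1 by lra.
  have := telescope_power_bound _ _ q0 nx0.
  have -> : n%:R + x + 1 = n.+1%:R + x by rewrite -natr1; ring.
  rewrite [q - 1 + 1]subrK -/(t n.+1) => h.
  have -> : series t n.+2 = series t n.+1 + t n.+1.
    by rewrite seriesEnat /= big_nat_recr.
  lra.
apply: nondecreasing_is_cvgn.
  apply/nondecreasing_seqP => n; rewrite seriesEnat /= big_nat_recr//=.
  by rewrite lerDl expR_ge0.
(* This is [bnd] with the subtracted exponential dropped; the empty partial sum is checked
   separately. *)
exists (t 0%N + expR (- (q - 1) * ln x) / (q - 1)) => _ [[|n] _ <-].
  by rewrite seriesEnat /= big_nil addr_ge0 ?divr_ge0 ?expR_ge0//; lra.
rewrite -lerBlDl ler_pdivlMr; last lra.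
rewrite mulrC (le_trans (bnd n))// lerBlDr lerDl expR_ge0//.
Qed.

Lemma cvg_complex {R : realType} (u : nat -> R[i]) :
  cvgn (fun n => complex.Re (u n)) -> cvgn (fun n => complex.Im (u n)) ->
  cvgn (u : nat -> R[i]^o).
Proof.
move=> /cvg_ex[/= a ua] /cvg_ex[/= b ub]; apply/cvg_ex; exists (a +i* b).
(* In the order of [R[i]], a positive radius has imaginary part 0; the real radius is then halved
   between the two coordinates. *)
apply/cvgrPdist_lt => /= -[e e']; rewrite ltcE /= => /andP[/eqP -> e0].
have e20 : 0 < e / 2 by lra.
move/cvgrPdist_lt: ua => /(_ _ e20) ua; move/cvgrPdist_lt: ub => /(_ _ e20) ub.
near=> n.
have ha : `|a - complex.Re (u n)| < e / 2 by near: n.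
have hb : `|b - complex.Im (u n)| < e / 2 by near: n.
rewrite complexr0 [X in `|X|]complexE (le_lt_trans (ler_normD _ _))//.
rewrite normrM norm_i mul1r !normc_def /= expr0n /= !addr0 !sqrtr_sqr -rmorphD ltcR.
case: (u n) ha hb => c d /=; lra.
Unshelve. all: by end_near.
Qed.

(** The real comparison test applies to the real and imaginary parts, each bounded by the
    modulus. *)
Lemma cvg_series_complex {R : realType} (u : nat -> R[i]) (v : nat -> R) :
  (forall n, `|u n| <= (v n)%:C) -> cvgn (series v) ->
  cvgn (series u : nat -> R[i]^o).
Proof.
move=> uv cv.
have v0 n : 0 <= v n by rewrite -ler0c (le_trans _ (uv n)).
have real_dominated (w : nat -> R) :
    (forall n, `|w n| <= v n) -> cvgn (series w).
  move=> wv; apply: (@normed_cvg R R^o).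
  exact: (series_le_cvg (fun n => normr_ge0 (w n)) v0 wv cv).
apply: cvg_complex.
- have -> : (fun n => complex.Re (series u n)) =
      series (fun n => complex.Re (u n)).
    apply/funext => n; rewrite seriesEnat /=.
    by apply: (big_morph (@complex.Re R)) => // -[a b] [c d].
  apply: real_dominated => n; rewrite -lecR.
  by rewrite (le_trans _ (uv n))// normc_ge_Re.
- have -> : (fun n => complex.Im (series u n)) =
      series (fun n => complex.Im (u n)).
    apply/funext => n; rewrite seriesEnat /=.
    by apply: (big_morph (@complex.Im R)) => // -[a b] [c d].
  apply: real_dominated => n; rewrite -lecR (le_trans _ (uv n))//.
  (* Im z = -Re(z i), and multiplication by i preserves the modulus. *)
  have := normc_ge_Re (u n * 'i%C); rewrite ReiNIm normrN normrM norm_i.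
  by rewrite mulr1.
Qed.

Lemma cvg_hurwitz {R : realType} (s : R[i]) (x : R) :
  1 < complex.Re s -> 0 < x ->
  cvgn (series (fun n => cpow (n%:R + x) (- s)) : nat -> R[i]^o).
Proof.
move=> s1 x0; apply: (cvg_series_complex _ _ _ (cvg_pseries _ _ s1 x0)) => n.
by rewrite norm_cpow; case: s {s1}.
Qed.

Lemma periodic_zetaE {R : realType} (s : R[i]) (x : R) :
  periodic_zeta s x =
  limn (series (fun n => unit_char x ^+ n.+1 * cpow n.+1%:R (- s))
        : nat -> R[i]^o).
Proof.
rewrite /periodic_zeta; congr (limn (series _ : nat -> R[i]^o)).
apply/funext => n; rewrite -unit_charMn /unit_char; congr (cexp _ * _).
by rewrite rmorphM rmorph_nat mulrA.
Qed.

Lemma norm_unit_char {R : realType} (x : R) : `|unit_char x| = 1.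
Proof. by rewrite unit_charE normc_def /= cos2Dsin2 sqrtr1. Qed.

Lemma cvg_periodic {R : realType} (s : R[i]) (x : R) : 1 < complex.Re s ->
  cvgn (series (fun n => unit_char x ^+ n.+1 * cpow n.+1%:R (- s))
        : nat -> R[i]^o).
Proof.
move=> s1; apply: (cvg_series_complex _ _ _ (cvg_pseries _ _ s1 ltr01)) => n.
rewrite normrM normrX norm_unit_char expr1n mul1r norm_cpow natr1.
by case: s {s1}.
Qed.

(** * Splitting F by residue classes *)

Lemma limn_subseq {K : numFieldType} {V : normedModType K} (u : nat -> V)
    (f : nat -> nat) :
  (f @ \oo --> \oo)%classic -> cvgn u -> limn (u \o f) = limn u.
Proof.
by move=> foo cu; apply: (cvg_lim (@norm_hausdorff _ V)); exact: cvg_comp cu.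
Qed.

Lemma limn_lin_comb {K : numFieldType} (c : K) (n : nat) (a : 'I_n -> K)
    (u : 'I_n -> nat -> K) :
  (forall i, cvgn (u i : nat -> K^o)) ->
  limn ((fun N => c * \sum_i a i * u i N) : nat -> K^o) =
  c * \sum_i a i * limn (u i : nat -> K^o).
Proof.
move=> cu; apply: (cvg_lim (@norm_hausdorff _ K^o)).
apply: (@cvgMl_tmp K); apply: (@cvg_big K^o).
  by move=> z; exact: (@add_continuous K^o).
by move=> i _; apply: (@cvgMl_tmp K); exact: cu.
Qed.

(** Passing from N to N + 1 adds a block of k indices, one in each residue class. *)
Lemma series_residues {V : zmodType} (u : nat -> V) (k N : nat) :
  series u (k * N)%N = \sum_(r < k) series (fun n => u (k * n + r)%N) N.
Proof.
elim: N => [|N IHN].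
  rewrite muln0 seriesEnat /= big_geq// big1// => r _.
  by rewrite seriesEnat /= big_geq.
under eq_bigr do rewrite seriesS; rewrite big_split /= -IHN addrC.
rewrite seriesEnat /= (big_cat_nat _ (n := (k * N)%N)) ?leq_mul//=.
congr (_ + _).
rewrite -{1}[(k * N)%N]add0n mulnS big_addn addnK big_mkord.
by apply: eq_bigr => r _; rewrite addnC.
Qed.

(** The index k n + r + 1 equals k (n + (r + 1)/k), and the character sees only r + 1 because its
    k-th power is 1. *)
Lemma periodic_zeta_hurwitz {R : realType} (s : R[i]) (k : nat) (x : R) :
  1 < complex.Re s -> (0 < k)%N -> unit_char x ^+ k = 1 ->
  periodic_zeta s x = cpow k%:R (- s) *
    \sum_(r < k) unit_char x ^+ r.+1 * hurwitz_zeta s (r.+1%:R / k%:R).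
Proof.
move=> s1 k0 xk; have kR : 0 < k%:R :> R by rewrite ltr0n.
have part0 (r : nat) : 0 < r.+1%:R / k%:R :> R by rewrite divr_gt0.
rewrite -(limn_lin_comb _ k _
  (fun r => series (fun n => cpow (n%:R + r.+1%:R / k%:R) (- s)))); last first.
  by move=> r; apply: cvg_hurwitz.
(* As the series converges, its limit can be taken along partial sums of length k N, which split
   evenly into residue classes. *)
rewrite periodic_zetaE -(limn_subseq _ (muln k)) //; last 2 first.
- exact: cvg_mulnl.
- exact: cvg_periodic.
congr (limn (_ : nat -> R[i]^o)); apply/funext => N /=.
rewrite series_residues mulr_sumr; apply: eq_bigr => r _.
rewrite !seriesEnat /= mulrA mulr_sumr; apply: eq_bigr => n _.
have -> : (k * n + r).+1%:R = k%:R * (n%:R + r.+1%:R / k%:R) :> R.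
  by rewrite -addnS natrD natrM; field; rewrite gt_eqF.
rewrite cpowM ?ltr_wpDl// -addnS exprD exprM xk expr1n mul1r.
by rewrite mulrCA mulrA.
Qed.

(** * Orthogonality *)

(** This is a geometric sum whose ratio z satisfies z^k = 1. If z differs from 1 it vanishes, since
    (z - 1) times it is z^k - 1. *)
Lemma sum_unit_char {R : realType} (k : nat) (m : int) : (0 < k)%N ->
  \sum_(a < k) unit_char (m%:~R / k%:R : R) ^+ a =
  if (k %| m)%Z then k%:R else 0.
Proof.
move=> k0; have kR : k%:R != 0 :> R by rewrite pnatr_eq0 -lt0n.
case: ifP => [/dvdzP[q ->]|ndvd].
  rewrite intrM mulfK// unit_char_int.
  by rewrite (eq_bigr (fun=> 1)) ?sumr_const ?card_ord// => i _; rewrite expr1n.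
set z := unit_char _; have zk : z ^+ k = 1.
  by rewrite -unit_charMn mulrC divfK// unit_char_int.
have z1 : z - 1 != 0.
  rewrite subr_eq0; apply/negP => /eqP.
  (* Only m mod k matters, and (m mod k)/k lies in [0, 1), where the character is 1 only at 0. *)
  rewrite /z (divz_eq m k) intrD intrM mulrDl mulfK// unit_charD unit_char_int.
  rewrite mul1r => /unit_char_eq1 h.
  have /eqP : (m %% k)%Z%:~R / k%:R = 0 :> R.
    apply: h; rewrite divr_ge0 ?ler0n ?ler0z ?modz_ge0 ?gt_eqF//=.
    rewrite ltr_pdivrMr ?ltr0n// mul1r.
    by rewrite (_ : k%:R = k%:Z%:~R)// ltr_int ltz_pmod.
  rewrite mulf_eq0 invr_eq0 (negbTE kR) orbF intr_eq0 => /eqP/dvdz_mod0P.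
  by rewrite ndvd.
by apply: (mulfI z1); rewrite -subrX1 zk subrr mulr0.
Qed.

(** * Multiplication by h on residues *)

(* [residue k h a + 1] is the representative of [a h] modulo [k + 1] lying in
   [1, k + 1], so that multiples of the modulus give the parameter 1 of zeta. *)
Definition residue (k : nat) (h : int) (a : 'I_k.+1) : 'I_k.+1 :=
  inord `|((a%:Z * h - 1) %% k.+1%:Z)%Z|%N.

Lemma residueP (k : nat) (h : int) (a : 'I_k.+1) :
  (k.+1 %| a%:Z * h - (residue k h a).+1%:Z)%Z.
Proof.
have k1 : 0 < k.+1%:Z by [].
have r0 : 0 <= ((a%:Z * h - 1) %% k.+1%:Z)%Z by rewrite modz_ge0.
have rk := ltz_pmod (a%:Z * h - 1) k1.
rewrite /residue inordK; last by rewrite -ltz_nat gez0_abs.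
rewrite -[`|_|%N.+1]addn1 PoszD gez0_abs//.
apply/dvdzP; exists ((a%:Z * h - 1) %/ k.+1%:Z)%Z.
by move: (divz_eq (a%:Z * h - 1) k.+1) => /=; set q := divz _ _; lia.
Qed.

Lemma ord_eq_mod (k : nat) (i j : 'I_k.+1) :
  (k.+1 %| i%:Z - j%:Z)%Z -> i = j.
Proof.
rewrite -eqz_mod_dvd !modz_nat => /eqP[].
by rewrite !modn_small// => /val_inj.
Qed.

Lemma residue_uniq (k : nat) (h : int) (a t : 'I_k.+1) :
  (k.+1 %| a%:Z * h - t.+1%:Z)%Z -> t = residue k h a.
Proof.
move=> ht; apply: ord_eq_mod.
have -> : t%:Z - (residue k h a)%:Z = (a%:Z * h - (residue k h a).+1%:Z)
   - (a%:Z * h - t.+1%:Z) by lia.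
by rewrite rpredB// residueP.
Qed.

(** As h is a unit modulo k + 1, a h determines a. On a finite type this makes [residue] a
    bijection, fit for reindexing sums. *)
Lemma residue_inj (k : nat) (h : int) : coprimez k.+1 h ->
  injective (residue k h).
Proof.
move=> ckh a b eqab; apply: ord_eq_mod.
rewrite -(Gauss_dvdzl _ ckh).
have -> : (a%:Z - b%:Z) * h = (a%:Z * h - (residue k h a).+1%:Z)
   - (b%:Z * h - (residue k h b).+1%:Z) by rewrite eqab; ring.
by rewrite rpredB// residueP.
Qed.

(** The representative k + 1 would make k + 1 divide a h, hence a, which is impossible for 0 < a < k
    + 1. The quotient is thus below 1 and is the fractional part. *)
Lemma hurwitz_residue {R : realType} (s : R[i]) (k : nat) (h : int)
    (a : 'I_k.+1) : coprimez k.+1 h -> (0 < a)%N ->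
  hurwitz_zeta s ((residue k h a).+1%:R / k.+1%:R) =
  hurwitz_zeta s (fracpart ((a%:Z * h)%:~R / k.+1%:R)).
Proof.
move=> ckh a0; congr hurwitz_zeta.
have kR : 0 < k.+1%:R :> R by rewrite ltr0n.
have /dvdzP[q hq] := residueP k h a.
have {}hq : a%:Z * h = q * k.+1%:Z + (residue k h a).+1%:Z by lia.
have rk : ((residue k h a).+1 < k.+1)%N.
  rewrite ltn_neqAle ltn_ord andbT; apply/eqP => rk.
  have : (k.+1 %| a%:Z * h)%Z by rewrite hq rk rpredD// dvdz_mull.
  by rewrite (Gauss_dvdzl _ ckh) dvdzE /= => /dvdn_leq -/(_ a0);
    rewrite leqNgt ltn_ord.
rewrite hq intrD intrM mulrDl mulfK ?gt_eqF// /fracpart (floor_def (m := q)).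
  by rewrite addrAC subrr add0r.
rewrite lerDl divr_ge0 ?ler0n// intrD ltrD2l ltr_pdivrMr// mul1r.
by rewrite ltr_nat.
Qed.

Lemma hurwitz_residue0 {R : realType} (s : R[i]) (k : nat) (h : int) :
  hurwitz_zeta s ((residue k h ord0).+1%:R / k.+1%:R) = riemann_zeta s.
Proof.
have <- : (ord_max : 'I_k.+1) = residue k h ord0.
  by apply: residue_uniq; rewrite mul0r sub0r rpredN.
by rewrite divff ?pnatr_eq0.
Qed.

(** * The identity over all residues *)

Lemma periodic_zeta0 {R : realType} (s : R[i]) :
  periodic_zeta s 0 = riemann_zeta s.
Proof.
rewrite periodic_zetaE /riemann_zeta /hurwitz_zeta.
congr (limn (series _ : nat -> R[i]^o)); apply/funext => n.
by rewrite unit_char0 expr1n mul1r natr1.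
Qed.

Lemma sum_periodic_zeta {R : realType} (k : nat) (h1 h2 : int) (s1 s2 : R[i]) :
  coprimez k.+1 h1 -> coprimez k.+1 h2 ->
  1 < complex.Re s1 -> 1 < complex.Re s2 ->
  cpow k.+1%:R (s1 + s2 - 1) *
  \sum_(a < k.+1)
     periodic_zeta s1 ((a%:Z * h2)%:~R / k.+1%:R) *
     periodic_zeta s2 (- ((a%:Z * h1)%:~R / k.+1%:R)) =
  \sum_(a < k.+1)
     hurwitz_zeta s1 ((residue k h1 a).+1%:R / k.+1%:R) *
     hurwitz_zeta s2 ((residue k h2 a).+1%:R / k.+1%:R).
Proof.
move=> c1 c2 hs1 hs2.
have kR : 0 < k.+1%:R :> R by rewrite ltr0n.
set Z1 := fun r : nat => hurwitz_zeta s1 (r.+1%:R / k.+1%:R).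
set Z2 := fun r : nat => hurwitz_zeta s2 (r.+1%:R / k.+1%:R).
have root (m : int) : unit_char (m%:~R / k.+1%:R : R) ^+ k.+1 = 1.
  by rewrite -unit_charMn mulrC divfK ?gt_eqF// unit_char_int.
have charM (m : int) (n : nat) : unit_char (m%:~R / k.+1%:R : R) ^+ n =
    unit_char ((n%:Z * m)%:~R / k.+1%:R).
  by rewrite -unit_charMn intrM mulrA.
have expand (a : 'I_k.+1) :
    periodic_zeta s1 ((a%:Z * h2)%:~R / k.+1%:R) *
    periodic_zeta s2 (- ((a%:Z * h1)%:~R / k.+1%:R)) =
    cpow k.+1%:R (- s1) * cpow k.+1%:R (- s2) *
    \sum_(r < k.+1) \sum_(t < k.+1) Z1 r * Z2 t *
      unit_char ((r.+1%:Z * h2 - t.+1%:Z * h1)%:~R / k.+1%:R) ^+ a.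
  rewrite -mulNr -mulrNz !(@periodic_zeta_hurwitz _ _ k.+1)//.
  rewrite mulrACA; congr (_ * _); rewrite mulr_suml; apply: eq_bigr => r _.
  rewrite mulr_sumr; apply: eq_bigr => t _; rewrite !charM.
  rewrite mulrACA mulrC; congr (_ * _).
  have -> : a%:Z * (r.+1%:Z * h2 - t.+1%:Z * h1) =
      r.+1%:Z * (a%:Z * h2) + t.+1%:Z * - (a%:Z * h1) by ring.
  by rewrite intrD mulrDl unit_charD.
under eq_bigr do rewrite expand.
rewrite -mulr_sumr mulrA.
(* The powers collapse to 1/(k + 1), which will cancel the k + 1 produced by orthogonality. *)
have -> : cpow k.+1%:R (s1 + s2 - 1) *
    (cpow k.+1%:R (- s1) * cpow k.+1%:R (- s2)) = k.+1%:R^-1 :> R[i].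
  apply: (mulIf (x := k.+1%:R)); first by rewrite pnatr_eq0.
  have <- : cpow k.+1%:R 1 = k.+1%:R :> R[i] by rewrite cpow_r1 ?rmorph_nat.
  rewrite -!cpowD; have -> : s1 + s2 - 1 + (- s1 + - s2) + 1 = 0 by ring.
  by rewrite cpow_r1// rmorph_nat mulVf ?pnatr_eq0// /cpow mul0r cexp0.
(* The sum over r goes outside and r is replaced by the residue of a h1; from here on [a] is this
   new index. *)
rewrite exchange_big /= mulr_sumr (reindex_inj (residue_inj _ _ c1)) /=.
apply: eq_bigr => a _; rewrite exchange_big /=.
under eq_bigr do rewrite -mulr_sumr sum_unit_char//.
(* Since r = a h1, the congruence r h2 = t h1 reads h1 (a h2 - t) = 0; cancelling the unit h1 leaves
   t = a h2. *)
have solve (t : 'I_k.+1) : (k.+1 %| (residue k h1 a).+1%:Z * h2 -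
    t.+1%:Z * h1)%Z = (t == residue k h2 a).
  have -> : (residue k h1 a).+1%:Z * h2 - t.+1%:Z * h1 =
      h1 * (a%:Z * h2 - t.+1%:Z) - (a%:Z * h1 - (residue k h1 a).+1%:Z) * h2.
    by ring.
  rewrite rpredBr; last by rewrite dvdz_mulr// residueP.
  rewrite (Gauss_dvdzr _ c1).
  by apply/idP/eqP => [/residue_uniq|->]; last exact: residueP.
rewrite (bigD1 (residue k h2 a)) //= [X in _ + X]big1 ?addr0; last first.
  by move=> t /negbTE tn; rewrite solve tn mulr0.
by rewrite solve eqxx mulrCA mulVf ?mulr1 ?pnatr_eq0.
Qed.

Theorem theorem6 (R : realType) (k : nat) (h1 h2 : int) (s1 s2 : R[i])
    (hk : (0 < k)%N)
    (hh1 : gcdz h1 k%:Z = 1) (hh2 : gcdz h2 k%:Z = 1)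
    (hs1 : 1 < complex.Re s1) (hs2 : 1 < complex.Re s2) :
  let D : R[i] :=
    \sum_(1 <= a < k)
      hurwitz_zeta s1 (fracpart ((a%:Z * h1)%:~R / k%:R)) *
      hurwitz_zeta s2 (fracpart ((a%:Z * h2)%:~R / k%:R)) in
  D = (cpow k%:R (s1 + s2 - 1) - 1) * riemann_zeta s1 * riemann_zeta s2 +
      cpow k%:R (s1 + s2 - 1) *
      \sum_(1 <= a < k)
        periodic_zeta s1 ((a%:Z * h2)%:~R / k%:R) *
        periodic_zeta s2 (- ((a%:Z * h1)%:~R / k%:R)).
Proof.
case: k hk hh1 hh2 => // k _ hh1 hh2 /=.
have c1 : coprimez k.+1 h1 by rewrite /coprimez gcdzC hh1.
have c2 : coprimez k.+1 h2 by rewrite /coprimez gcdzC hh2.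
have := sum_periodic_zeta k h1 h2 s1 s2 c1 c2 hs1 hs2.
(* The terms a = 0 are split off on both sides; both are zeta(s1) zeta(s2), the one from F carrying
   the power of k + 1. Moving the other across yields the coefficient with -1. *)
rewrite !big_ord_recl 2!hurwitz_residue0 !mul0r oppr0 2!periodic_zeta0 mulrDr.
under [X in _ = _ + X]eq_bigr do rewrite !hurwitz_residue//.
rewrite !big_add1 !big_mkord /= => h.
rewrite mulrBl mul1r mulrBl -addrA [- _ + _]addrC addrA -mulrA h.
by rewrite addrC addKr.
Qed.
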